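(* Let $(H^+,\oplus)$ be a gyrogroup, let $H^-$ be a set disjoint from $H^+$ with $|H^+|=|H^-|$, let $\varphi:H^+\to H^-$ be a bijection, and let $(G,\otimes)$ with $G=H^+\cup H^-$ be the gyrogroup constructed from these data (as defined in the context). Let $M$ be a non-empty subset of $G$. Then $M$ is a normal subgyrogroup of $G$ if and only if at least one of the following conditions is satisfied: (1) $M \unlhd H^+$; (2) there exist $N^+ \unlhd H^+$ and $L^- \subseteq H^-$ such that $M = N^+ \cup L^-$ and for all $x, y \in L^-$, $x \otimes y \in N^+$; moreover, $N^+ \cap L^+ = \emptyset$ and $N^+ \cup L^+ \unlhd H^+$, where $L^+ = \varphi^{-1}(L^-)$; (3) $M = N^+ \cup N^-$ for some $N^+ \unlhd H^+$, where $N^- = \varphi(N^+)$.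
   Context: A groupoid is a set with a binary operation. A groupoid $(T,\star)$ with a left identity such that each element of $T$ has a left inverse is called a gyrogroup if (i) there exists a function $\mathrm{gyr}: T\times T\to \mathrm{Aut}(T)$ (where $\mathrm{Aut}(T)$ is the group of automorphisms of the groupoid $(T,\star)$) such that for all $a,b,c\in T$, $a\star(b\star c)=(a\star b)\star \mathrm{gyr}[a,b]c$, where $\mathrm{gyr}[a,b]c=\mathrm{gyr}(a,b)(c)$; and (ii) for all $a,b\in T$, $\mathrm{gyr}[a,b]=\mathrm{gyr}[a\star b,b]$. A non-empty subset $H$ of a gyrogroup $T$ is a subgyrogroup of $T$ if it is a gyrogroup under the operation induced from $T$. A subset $H$ of $T$ is a normal subgyrogroup of $T$, written $H\unlhd T$, if $H$ is the kernel of a homomorphism (a map preserving the operations) from $T$ to some gyrogroup. Construction of $G$: let $(H^+,\oplus)$ be a gyrogroup, $H^-$ a non-empty set disjoint from $H^+$ with $|H^+|=|H^-|$, and $\varphi:H^+\to H^-$ a bijection. Elements of $H^+$ are written $a^+$, and $a^-:=\varphi(a^+)$; likewise $(a^+\oplus b^+)^-:=\varphi(a^+\oplus b^+)$. Put $G=H^+\cup H^-$, and for $a^\epsilon,b^\delta\in G$ with $\epsilon,\delta\in\{+,-\}$ define $$a^{\epsilon}\otimes b^{\delta}=\begin{cases} a^{+}\oplus b^{+} & \text{if } \epsilon=\delta,\\ (a^{+}\oplus b^{+})^{-} & \text{if } \epsilon\neq\delta.\end{cases}$$ Then $(G,\otimes)$ is a gyrogroup, with gyrations $\mathrm{gyr}_G[a^\epsilon,b^\delta](t^+)=\mathrm{gyr}_{H^+}[a^+,b^+](t^+)$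 and $\mathrm{gyr}_G[a^\epsilon,b^\delta](t^-)=(\mathrm{gyr}_{H^+}[a^+,b^+](t^+))^-$. *)

(* Defs.v *)
From HB Require Import structures.
From mathcomp Require Import all_boot.
From mathcomp Require Import boolp classical_sets.

Set Implicit Arguments.
Unset Strict Implicit.
Unset Printing Implicit Defensive.

Local Open Scope group_scope.
Local Open Scope classical_set_scope.

Definition automorphism (T : magmaType) (f : T -> T) : Prop :=
  bijective f /\ {morph f : a b / a * b}.

HB.mixin Record BaseUMagma_isGyrogroup T of BaseUMagma T := {
  gyro_mul1g : left_id (1 : T) *%g;
  gyro_mulVg : forall a : T, exists b : T, b * a = 1;
  gyro_gyrP : exists gyr : T -> T -> T -> T,
    [/\ forall a b, automorphism (gyr a b),
        forall a b c, a * (b * c) = (a * b) * gyr a b c &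
        forall a b, gyr a b = gyr (a * b) b]
}.

#[short(type="gyrogroupType")]
HB.structure Definition Gyrogroup :=
  {T of BaseUMagma_isGyrogroup T & BaseUMagma T}.

Bind Scope group_scope with Gyrogroup.sort.

Definition gyrokernel (T K : gyrogroupType) (f : {multiplicative T -> K}) :
  set T := f @^-1` [set 1].

Definition normal_subgyrogroup (T : gyrogroupType) (N : set T) : Prop :=
  exists (K : gyrogroupType) (f : {multiplicative T -> K}), N = gyrokernel f.

(* The union of the disjoint sets H^+ and H^- is rendered by the sum of two
   types; [phi] is a parameter of the type because the operation depends
   on it. *)
Definition gyrodouble (Hp : gyrogroupType) (Hm : Type) (phi : Hp -> Hm)
  (bphi : bijective phi) : Type := (Hp + Hm)%type.

Section GyroDouble.
Variables (Hp : gyrogroupType) (Hm : Type) (phi : Hp -> Hm).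
Hypothesis bphi : bijective phi.

Local Notation G := (gyrodouble bphi).

Definition gpos (a : Hp) : G := inl a.
Definition gneg (x : Hm) : G := inr x.

Lemma phi_surj (x : Hm) : exists a, phi a = x.
Proof. by case: bphi => psi _ psiK; exists (psi x). Qed.

Definition phi_inv (x : Hm) : Hp := sval (cid (phi_surj x)).

Lemma phi_invK : cancel phi_inv phi.
Proof. by move=> x; rewrite /phi_inv; case: cid. Qed.

Lemma phiK : cancel phi phi_inv.
Proof. by move=> a; apply: (bij_inj bphi); rewrite phi_invK. Qed.

(* The element a^+ underlying a^+ or a^- = phi a^+. *)
Definition gbase (u : G) : Hp :=
  match u with inl a => a | inr x => phi_inv x end.

Definition gsign (u : G) : bool := if u is inl _ then true else false.

(* a^eps for eps given by [s] ([true] standing for +). *)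
Definition gsigned (s : bool) (a : Hp) : G :=
  if s then gpos a else gneg (phi a).

Definition gyrodouble_mul (u v : G) : G :=
  gsigned (gsign u == gsign v) (gbase u * gbase v).

HB.instance Definition _ := hasMul.Build G gyrodouble_mul.
HB.instance Definition _ := hasOne.Build G (gpos 1).

Lemma gyrodouble_mulE (u v : G) :
  u * v = gsigned (gsign u == gsign v) (gbase u * gbase v).
Proof. by []. Qed.

Lemma gbase_signed s a : gbase (gsigned s a) = a.
Proof. by case: s => //=; rewrite phiK. Qed.

Lemma gsign_signed s a : gsign (gsigned s a) = s.
Proof. by case: s. Qed.

Lemma gsignedK u : gsigned (gsign u) (gbase u) = u.
Proof. by case: u => //= x; rewrite /gneg phi_invK. Qed.

Lemma gyrodouble_mul1g : left_id (1 : G) *%g.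
Proof.
move=> u; rewrite !gyrodouble_mulE /= gyro_mul1g.
by rewrite -[RHS]gsignedK; case: (gsign u).
Qed.

Lemma gyrodouble_mulVg (u : G) : exists v : G, v * u = 1.
Proof.
have [b ba] := gyro_mulVg (gbase u); exists (gsigned (gsign u) b).
by rewrite !gyrodouble_mulE gbase_signed gsign_signed eqxx ba.
Qed.

Lemma gyrodouble_gyrP : exists gyr : G -> G -> G -> G,
  [/\ forall u v, automorphism (gyr u v),
      forall u v w, u * (v * w) = (u * v) * gyr u v w &
      forall u v, gyr u v = gyr (u * v) v].
Proof.
have [gyr [gyr_aut gyrA gyrL]] := @gyro_gyrP Hp.
exists (fun u v w => gsigned (gsign w) (gyr (gbase u) (gbase v) (gbase w))).
split.
- move=> u v; have [[g gK Kg] gM] := gyr_aut (gbase u) (gbase v); split.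
    exists (fun w => gsigned (gsign w) (g (gbase w))) => w.
      by rewrite gbase_signed gsign_signed gK gsignedK.
    by rewrite gbase_signed gsign_signed Kg gsignedK.
  move=> w t; rewrite !gyrodouble_mulE.
  by rewrite !gbase_signed !gsign_signed gM.
- move=> u v w; rewrite !gyrodouble_mulE.
  rewrite !gbase_signed !gsign_signed gyrA.
  by case: (gsign u); case: (gsign v); case: (gsign w).
- move=> u v; apply/funext => w.
  by rewrite !gyrodouble_mulE gbase_signed -gyrL.
Qed.

HB.instance Definition _ := BaseUMagma_isGyrogroup.Build G
  gyrodouble_mul1g gyrodouble_mulVg gyrodouble_gyrP.

End GyroDouble.

Arguments gpos {Hp Hm phi} bphi a.
Arguments gneg {Hp Hm phi} bphi x.

(* Main.v *)
(** [G] is the product of [H^+] with the group of signs.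

    If [M] is the kernel of [f] and contains no pair [a^+], [a^-], then [f 1^-]
    has order two and [N^+ U L^+] is the class of [1] for the congruence
    "[f a^+ = f b^+] or [f a^+ = f b^-]" on [H^+]. It is normal because a
    congruence that satisfies left cancellation has a quotient gyrogroup.

    Conversely, under condition (2) with [l^-] in [L^-], let [h] have kernel
    [N^+]. As [N^+] has index two in the normal subgyrogroup [N^+ U L^+], the
    element [k := h l] satisfies [k * k = 1] and can be moved freely through
    products, so [a^+ |-> h a], [a^- |-> h a * k] is a homomorphism; its kernel
    is [M]. *)
Require Import Defs.
From HB Require Import structures.
From mathcomp Require Import all_boot.
From mathcomp Require Import boolp classical_sets.

Set Implicit Arguments.
Unset Strict Implicit.
Unset Printing Implicit Defensive.

Local Open Scope group_scope.
Local Open Scope classical_set_scope.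

(** * Cancellation laws in a gyrogroup *)

Section GyrogroupTheory.
Variable T : gyrogroupType.
Implicit Types a b c x y z : T.

(** The loop property turns [gyr b a] into [gyr (b * a) a = gyr 1 a], and [gyr 1 a] is the
    identity. *)
Lemma gyro_mulKg a b : b * a = 1 -> forall c, b * (a * c) = c.
Proof.
have [gyr [gyr_aut gyrA gyrL]] := @gyro_gyrP T.
move=> ba c; have gyr1 : gyr 1 a c = c.
  have aE := gyrA 1 a c; rewrite !gyro_mul1g in aE.
  (* Expanding [d * (a * c)] directly and through [aE] gives [gyr d a (gyr 1 a c) = gyr d a c]; the
     automorphism [gyr d a] is injective. *)
  have [d da] := gyro_mulVg a; have := gyrA d a c; rewrite {1}aE gyrA.
  have [[h hK _] _] := gyr_aut d a.
  by rewrite da !gyro_mul1g => /(congr1 h); rewrite !hK.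
by rewrite gyrA ba gyro_mul1g gyrL ba.
Qed.

Lemma gyro_mulgI a b c : a * b = a * c -> b = c.
Proof.
have [d da] := gyro_mulVg a.
by move=> /(congr1 (fun x => d * x)); rewrite !(gyro_mulKg da).
Qed.

Lemma gyro_idempotent a : a * a = a -> a = 1.
Proof.
have [b ba] := gyro_mulVg a.
by move=> aa; rewrite -(gyro_mulKg ba a) aa ba.
Qed.

Lemma gyro_mulg1 a : a * 1 = a.
Proof.
have [b ba] := gyro_mulVg a; apply: (@gyro_mulgI b).
by rewrite (gyro_mulKg ba) ba.
Qed.

Lemma gyro_mulVg_mulgV a b : b * a = 1 -> a * b = 1.
Proof.
by move=> ba; apply: (@gyro_mulgI b); rewrite (gyro_mulKg ba) gyro_mulg1.
Qed.

Lemma gyro_mulKVg a b : b * a = 1 -> forall c, a * (b * c) = c.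
Proof. by move=> /gyro_mulVg_mulgV; apply: gyro_mulKg. Qed.

Lemma gyro_mulIg a x y : x * a = y * a -> x = y.
Proof.
have [gyr [_ gyrA gyrL]] := @gyro_gyrP T.
have [b /gyro_mulVg_mulgV ab] := gyro_mulVg a.
(* By the loop property, [x] is recovered from [x * a] and [a]. *)
have xE z : z = (z * a) * gyr (z * a) a b.
  by rewrite -gyrL -gyrA ab gyro_mulg1.
by move=> xya; rewrite (xE x) (xE y) xya.
Qed.

End GyrogroupTheory.

(** * Kernels, congruences and quotient gyrogroups *)

Lemma gyro_gmulf1 (T K : gyrogroupType) (f : {multiplicative T -> K}) :
  f 1 = 1.
Proof. by apply: gyro_idempotent; rewrite -gmulfM gyro_mul1g. Qed.

Lemma normal_subgyrogroup_ker (T K : gyrogroupType) (f : T -> K)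
  (N : set T) : {morph f : x y / x * y} -> (forall x, N x <-> f x = 1) ->
  normal_subgyrogroup N.
Proof.
move=> fM NE; pose fH := isMultiplicative.Build T K f fM.
pose F : {multiplicative T -> K} := HB.pack f fH.
by exists K, F; apply/predeqP => x; apply: NE.
Qed.

(** Left cancellation modulo [E] makes gyrations compatible with [E]: it lets [x * y] be cancelled
    in [(x * y) * gyr x y z = x * (y * z)]. *)
Record gyrocongruence {T : gyrogroupType} (E : T -> T -> Prop) : Prop := {
  gyrocong_refl : forall x, E x x;
  gyrocong_sym : forall x y, E x y -> E y x;
  gyrocong_trans : forall x y z, E x y -> E y z -> E x z;
  gyrocong_mul : forall x x' y y', E x x' -> E y y' -> E (x * y) (x' * y');
  gyrocong_mulI : forall x y z, E (x * y) (x * z) -> E y z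
}.

(** The points are the classes themselves, as subsets of [T]. The type carries [cE] because the
    gyrogroup laws of the quotient rest on it. *)
Definition gyroquot {T : gyrogroupType} (E : T -> T -> Prop)
  (cE : gyrocongruence E) : Type := {A : set T | exists x, A = E x}.

Section GyroQuotient.
Variables (T : gyrogroupType) (E : T -> T -> Prop) (cE : gyrocongruence E).

Local Notation Q := (gyroquot cE).

Definition gyropi (x : T) : Q := exist _ (E x) (ex_intro _ x erefl).

Lemma gyropi_eqP x y : gyropi x = gyropi y <-> E x y.
Proof.
split=> [/(congr1 sval) /= -> |Exy]; first exact: gyrocong_refl.
apply: eq_exist; apply/predeqP => z; split; apply: gyrocong_trans => //.
exact: gyrocong_sym.
Qed.

Definition gyrorepr (A : Q) : T := sval (cid (svalP A)).

Lemma gyroreprK : cancel gyrorepr gyropi.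
Proof.
by case=> A Ax; apply: eq_exist; rewrite /gyrorepr; case: cid => x /= <-.
Qed.

Lemma gyrorepr_pi x : E (gyrorepr (gyropi x)) x.
Proof. by apply/gyropi_eqP; rewrite gyroreprK. Qed.

HB.instance Definition _ :=
  hasMul.Build Q (fun A B => gyropi (gyrorepr A * gyrorepr B)).
HB.instance Definition _ := hasOne.Build Q (gyropi 1).

Lemma gyropiM : {morph gyropi : x y / x * y}.
Proof.
move=> x y; apply/gyropi_eqP; apply: (gyrocong_sym cE).
by apply: gyrocong_mul => //; apply: gyrorepr_pi.
Qed.

Lemma gyroquot_mul1g : left_id (1 : Q) *%g.
Proof. by move=> A; rewrite -[A]gyroreprK -gyropiM gyro_mul1g. Qed.

Lemma gyroquot_mulVg (A : Q) : exists B : Q, B * A = 1.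
Proof.
have [y yx] := gyro_mulVg (gyrorepr A); exists (gyropi y).
by rewrite -{1}[A]gyroreprK -gyropiM yx.
Qed.

Lemma gyroquot_gyrP : exists gyr : Q -> Q -> Q -> Q,
  [/\ forall A B, automorphism (gyr A B),
      forall A B C, A * (B * C) = (A * B) * gyr A B C &
      forall A B, gyr A B = gyr (A * B) B].
Proof.
have [gyr [gyr_aut gyrA gyrL]] := @gyro_gyrP T.
have EI := gyrocong_mulI cE.
have gyrE x x' y y' z z' : E x x' -> E y y' -> E z z' ->
    E (gyr x y z) (gyr x' y' z').
  move=> Exx' Eyy' Ezz'; apply: (EI (x * y)); rewrite -gyrA.
  apply: (@gyrocong_trans _ _ cE _ (x' * (y' * z'))).
    by apply: gyrocong_mul => //; apply: gyrocong_mul.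
  rewrite gyrA; apply: gyrocong_mul => //; last exact: gyrocong_refl.
  by apply: gyrocong_sym => //; apply: gyrocong_mul.
pose gyrQ A B C := gyropi (gyr (gyrorepr A) (gyrorepr B) (gyrorepr C)).
have gyrQE x y z : gyrQ (gyropi x) (gyropi y) (gyropi z) = gyropi (gyr x y z).
  by apply/gyropi_eqP; apply: gyrE; apply: gyrorepr_pi.
exists gyrQ; split.
- move=> A B; have [[g gK Kg] gM] := gyr_aut (gyrorepr A) (gyrorepr B); split.
    exists (fun C => gyropi (g (gyrorepr C))) => C; last first.
      rewrite -[A]gyroreprK -[B]gyroreprK gyrQE Kg.
      exact: gyroreprK.
    rewrite -[RHS]gyroreprK; apply/gyropi_eqP.
    set x := gyrorepr A; set y := gyrorepr B.
    (* The inverse gyration [g] is not known to respect [E]. Multiplying by [y] and then by [x] on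
       the left produces [gyr x y (g _)], from which [Kg] removes [g]. *)
    apply: (EI y); apply: (EI x); rewrite !(gyrA x y) Kg.
    apply: gyrocong_mul => //; first exact: gyrocong_refl.
    exact: gyrorepr_pi.
  move=> C D; rewrite -[C]gyroreprK -[D]gyroreprK -[A]gyroreprK -[B]gyroreprK.
  by rewrite -gyropiM !gyrQE gM gyropiM.
- move=> A B C; rewrite -[A]gyroreprK -[B]gyroreprK -[C]gyroreprK.
  by rewrite gyrQE -!gyropiM gyrA.
- move=> A B; apply/funext => C.
  rewrite -[A]gyroreprK -[B]gyroreprK -[C]gyroreprK.
  by rewrite -gyropiM !gyrQE -gyrL.
Qed.

HB.instance Definition _ := BaseUMagma_isGyrogroup.Build Q
  gyroquot_mul1g gyroquot_mulVg gyroquot_gyrP.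

Lemma normal_subgyrogroup_cong : normal_subgyrogroup [set x | E x 1].
Proof.
apply: (@normal_subgyrogroup_ker _ Q gyropi _ gyropiM) => x.
by rewrite gyropi_eqP.
Qed.

End GyroQuotient.

(** * Index two: the kernel of [h] inside that of [h2], with [h l] the value of [h] on the other
    coset *)

Section NormalIndexTwo.
Variables (T K K2 : gyrogroupType).
Variables (h : {multiplicative T -> K}) (h2 : {multiplicative T -> K2}).
Variable l : T.
Hypothesis hl_neq1 : h l <> 1.
Hypothesis ker_h2 : forall p, h2 p = 1 <-> h p = 1 \/ h p = h l.

Let h2l : h2 l = 1. Proof. by apply/ker_h2; right. Qed.

(** The left quotient of [p] by [q] lies in the kernel of [h2], where [h] takes only the values [1]
    and [h l]. *)
Lemma index2_coset p q : h2 p = h2 q -> h p = h q \/ h p = h q * h l.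
Proof.
move=> pq; have [q' q'q] := gyro_mulVg q.
have pE : p = q * (q' * p) by rewrite (gyro_mulKVg q'q).
have /ker_h2[h1|h1] : h2 (q' * p) = 1.
- by rewrite gmulfM pq -gmulfM q'q gyro_gmulf1.
- by left; rewrite pE gmulfM h1 gyro_mulg1.
- by right; rewrite pE gmulfM h1.
Qed.

(** Since [h2 l = 1], [index2_coset] leaves two possible values for the left side. The other one,
    [h a * h b], would give [h l = 1] by cancellation. The same argument proves [index2_mulAC]. *)
Lemma index2_mulA a b : h a * (h b * h l) = (h a * h b) * h l.
Proof.
have : h2 (a * (b * l)) = h2 (a * b) by rewrite !gmulfM h2l gyro_mulg1.
case/index2_coset; rewrite !gmulfM // => /gyro_mulgI.
by rewrite -{2}(gyro_mulg1 (h b)) => /gyro_mulgI.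
Qed.

Lemma index2_mulAC a b : (h a * h l) * h b = (h a * h b) * h l.
Proof.
have : h2 ((a * l) * b) = h2 (a * b) by rewrite !gmulfM h2l gyro_mulg1.
case/index2_coset; rewrite !gmulfM // => /gyro_mulIg.
by rewrite -{2}(gyro_mulg1 (h a)) => /gyro_mulgI.
Qed.

End NormalIndexTwo.

(** * Computing in [G] by sign and base *)

Section GyroDoubleTheory.
Variables (Hp : gyrogroupType) (Hm : Type) (phi : Hp -> Hm).
Hypothesis bphi : bijective phi.

Local Notation G := (gyrodouble bphi).

Lemma gsignedM s t a b :
  gsigned bphi s a * gsigned bphi t b = gsigned bphi (s == t) (a * b).
Proof. by rewrite gyrodouble_mulE !gbase_signed !gsign_signed. Qed.

Lemma gposM : {morph gpos bphi : a b / a * b}.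
Proof. by move=> a b; rewrite [RHS](gsignedM true true). Qed.

Lemma gbaseM : {morph @gbase Hp Hm phi bphi : u v / u * v}.
Proof. by move=> u v; rewrite gyrodouble_mulE gbase_signed. Qed.

Lemma gsignM (u v : G) : gsign (u * v) = (gsign u == gsign v).
Proof. by rewrite gyrodouble_mulE gsign_signed. Qed.

Lemma image_gposE (N : set Hp) (u : G) :
  (gpos bphi @` N) u <-> gsign u /\ N (gbase u).
Proof.
split=> [[a Na <-] //|]; case: u => [a|x] /= [] // _ Na.
by exists a.
Qed.

Lemma image_gnegE (L : set Hm) (u : G) :
  (gneg bphi @` L) u <-> ~~ gsign u /\ L (phi (gbase u)).
Proof.
split=> [[x Lx <-] /=|]; first by rewrite phi_invK.
by case: u => [a|x] /= [] // _; rewrite phi_invK => Lx; exists x.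
Qed.

Lemma image_gUE (N : set Hp) (L : set Hm) (u : G) :
  (gpos bphi @` N `|` gneg bphi @` L) u <->
  if gsign u then N (gbase u) else L (phi (gbase u)).
Proof.
split=> [[/image_gposE|/image_gnegE]|]; first by case=> ->.
  by case=> /negPf ->.
case us: (gsign u) => Nu; [left; apply/image_gposE | right; apply/image_gnegE].
  by rewrite us.
by rewrite us.
Qed.

Lemma image_gneg_gsigned (L : set Hm) a :
  (gneg bphi @` L) (gsigned bphi false a) <-> L (phi a).
Proof. by rewrite image_gnegE gsign_signed gbase_signed; split=> [[]|]. Qed.

End GyroDoubleTheory.

Arguments gsignedM {Hp Hm phi bphi} s t a b.

(** * Each of the three conditions gives a kernel *)

Section GyroDoubleNormal.
Variables (Hp : gyrogroupType) (Hm : Type) (phi : Hp -> Hm).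
Hypothesis bphi : bijective phi.

Local Notation G := (gyrodouble bphi).

Lemma normal_subgyrogroup_gpos (N : set Hp) :
  normal_subgyrogroup N -> normal_subgyrogroup (gpos bphi @` N).
Proof.
move=> [K [h ->]]; have bid : bijective (@idfun K) by exists idfun.
(* The target is the double of [K] along [idfun]: [f] keeps the sign, so no negative element is sent
   to [1]. *)
pose f (u : G) := gsigned bid (gsign u) (h (gbase u)).
apply: (@normal_subgyrogroup_ker _ _ f) => [u v|u].
  by rewrite /f gsignedM gsignM gbaseM gmulfM.
rewrite image_gposE /f /gyrokernel /=; case: (gsign u); split.
- by case=> _ ->.
- by move=> [->].
- by case.
- by [].
Qed.

Lemma normal_subgyrogroup_both (N : set Hp) : normal_subgyrogroup N ->
  normal_subgyrogroup (gpos bphi @` N `|` gneg bphi @` (phi @` N)).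
Proof.
move=> [K [h ->]].
pose f (u : G) := h (gbase u).
apply: (@normal_subgyrogroup_ker _ _ f) => [u v|u]; rewrite /f.
  by rewrite gbaseM gmulfM.
rewrite image_gUE; case: (gsign u) => //.
by split=> [[a ha /(bij_inj bphi) <-] //|hu]; exists (gbase u).
Qed.

Lemma normal_subgyrogroup_twisted (N : set Hp) (L : set Hm) :
    normal_subgyrogroup N ->
    (forall u v : G, (gneg bphi @` L) u -> (gneg bphi @` L) v ->
      (gpos bphi @` N) (u * v)) ->
    N `&` (phi @^-1` L) = set0 ->
    normal_subgyrogroup (N `|` (phi @^-1` L)) ->
  normal_subgyrogroup (gpos bphi @` N `|` gneg bphi @` L).
Proof.
move=> nN LL NL0 [K2 [h2 h2E]]; have [L0|/set0P[l' Ll']] := eqVneq L set0.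
  by rewrite L0 image_set0 setU0; apply: normal_subgyrogroup_gpos.
case: nN => K [h NE]; have [l lE] := phi_surj bphi l'; rewrite -lE {l' lE} in Ll'.
have NhE a : N a <-> h a = 1 by rewrite NE.
have hLL a b : L (phi a) -> L (phi b) -> h a * h b = 1.
  move=> La Lb; rewrite -gmulfM; apply/NhE.
  have := LL (gsigned bphi false a) (gsigned bphi false b).
  rewrite gsignedM !image_gneg_gsigned image_gposE gbase_signed.
  by move=> /(_ La Lb) [].
have h2P a : h2 a = 1 <-> N a \/ L (phi a).
  by rewrite -[h2 a = 1]/(gyrokernel h2 a) -h2E.
have NLF a : N a -> L (phi a) -> False.
  by move=> Na La; have : (N `&` (phi @^-1` L)) a by []; rewrite NL0.
(* [L^+] is a whole fibre of [h]: if [h a = h l], then [a * l] is in [N^+], so [a] is in [N^+ U L^+]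
   because [l] is; [a] in [N^+] would put [l] in [N^+] too. *)
have LhE a : L (phi a) <-> h a = h l.
  split=> [La|hal]; first by apply: (@gyro_mulgI _ (h l)); rewrite !hLL.
  have h2l : h2 l = 1 by apply/h2P; right.
  have /h2P[/NhE|//] : h2 a = 1.
    rewrite -[LHS]gyro_mulg1 -[X in _ * X]h2l -gmulfM; apply/h2P; left.
    by apply/NhE; rewrite gmulfM hal hLL.
  by rewrite hal => /NhE/NLF/(_ Ll').
have hl_neq1 : h l <> 1 by move=> /NhE/NLF/(_ Ll').
have ker_h2 p : h2 p = 1 <-> h p = 1 \/ h p = h l.
  by rewrite h2P NhE LhE.
have mulA := index2_mulA hl_neq1 ker_h2.
have mulAC := index2_mulAC hl_neq1 ker_h2.
pose f (u : G) := h (gbase u) * (if gsign u then 1 else h l).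
apply: (@normal_subgyrogroup_ker _ _ f) => [u v|u].
  rewrite /f gsignM gbaseM gmulfM.
  (* Mixed signs are exactly [mulA] and [mulAC]. For two negative elements, both factors [h l] are
     moved to the right end, where their product is [1]. *)
  case: (gsign u); case: (gsign v); rewrite /= ?gyro_mulg1 //.
  rewrite -(gmulfM _ l) mulA gmulfM mulAC.
  by rewrite -(gmulfM (gbase u)) -mulA hLL ?gyro_mulg1.
rewrite image_gUE /f; case: (gsign u); first by rewrite gyro_mulg1.
rewrite LhE; split=> [->|hu]; first exact: hLL.
by apply: (@gyro_mulIg _ (h l)); rewrite hu hLL.
Qed.

(** * The congruence on [H^+] induced by a homomorphism on [G] *)

Section Kernel.
Variables (K : gyrogroupType) (f : {multiplicative G -> K}).

Let fM (u v : G) : f (u * v) = f u * f v. Proof. exact: gmulfM. Qed.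

Definition sign_cong (a b : Hp) : Prop :=
  exists s, f (gpos bphi a) = f (gsigned bphi s b).

(** Right multiplication by [gsigned s 1] changes the signs on both sides at once. *)
Let f_gsigned s b t c : f (gpos bphi b) = f (gsigned bphi t c) ->
  f (gsigned bphi s b) = f (gsigned bphi (t == s) c).
Proof.
move=> fbc; rewrite -[b in LHS]gyro_mulg1 -[c in RHS]gyro_mulg1 -gsignedM fM.
by rewrite -fbc -fM (gsignedM true) eq_sym eqb_id.
Qed.

Lemma sign_cong_gyrocongruence : gyrocongruence sign_cong.
Proof.
split.
- by move=> a; exists true.
- move=> a b [s fab]; exists s; have := f_gsigned s fab.
  by rewrite eqxx => <-.
- move=> a b c [s fab] [t fbc]; exists (t == s).
  by rewrite fab (f_gsigned s fbc).
- move=> a a' b b' [s fa] [t fb]; exists (s == t).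
  by rewrite gposM fM fa fb -fM gsignedM.
- move=> a b c [s]; rewrite gposM fM.
  (* The sign is put on the second factor, so that [f a^+] can be cancelled in [K]. *)
  have -> : gsigned bphi s (a * c) = gpos bphi a * gsigned bphi s c.
    by rewrite (gsignedM true) eq_sym eqb_id.
  by rewrite fM => /gyro_mulgI; exists s.
Qed.

End Kernel.
End GyroDoubleNormal.

Theorem theorem1p1 (Hp : gyrogroupType) (Hm : Type) (phi : Hp -> Hm)
    (bphi : bijective phi) (M : set (gyrodouble bphi)) (M_neq0 : M !=set0) :
  normal_subgyrogroup M <->
  [\/ exists2 N : set Hp, normal_subgyrogroup N & M = gpos bphi @` N,
      exists (N : set Hp) (L : set Hm),
        [/\ normal_subgyrogroup N,
            M = (gpos bphi @` N) `|` (gneg bphi @` L),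
            forall x y : gyrodouble bphi, (gneg bphi @` L) x ->
              (gneg bphi @` L) y -> (gpos bphi @` N) (x * y),
            N `&` (phi @^-1` L) = set0 &
            normal_subgyrogroup (N `|` (phi @^-1` L))] |
      exists2 N : set Hp, normal_subgyrogroup N &
        M = (gpos bphi @` N) `|` (gneg bphi @` (phi @` N))].
Proof.
split; last first.
  case=> [[N nN ->]|[N [L [nN -> LL NL0 nNL]]]|[N nN ->]].
  - exact: normal_subgyrogroup_gpos.
  - exact: normal_subgyrogroup_twisted.
  - exact: normal_subgyrogroup_both.
move=> [K [f ->]];
pose N := [set a | f (gpos bphi a) = 1]; pose L := [set x | f (gneg bphi x) = 1].
have nN : normal_subgyrogroup N.
  apply: (@normal_subgyrogroup_ker _ _ (f \o gpos bphi)) => // a b /=.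
  by rewrite gposM gmulfM.
have ME : gyrokernel f = gpos bphi @` N `|` gneg bphi @` L.
  apply/predeqP => u; rewrite image_gUE /gyrokernel /N /L /=.
  by rewrite -{1}[u]gsignedK /gsigned; case: (gsign u).
have fneg a : f (gneg bphi (phi a)) = f (gpos bphi a) * f (gneg bphi (phi 1)).
  by rewrite -gmulfM (gsignedM true false) gyro_mulg1.
(* A pair [a^+], [a^-] in the kernel forces [f 1^- = 1], hence condition (3). Otherwise condition
   (2) holds, including when [L] is empty. *)
have [[a [Na La]]|NL0] := pselect (N `&` phi @^-1` L !=set0).
  apply: Or33; exists N => //; rewrite ME; congr (_ `|` gneg bphi @` _).
  have f1 : f (gneg bphi (phi 1)) = 1.
    by rewrite -[LHS]gyro_mul1g -[X in X * _]Na -fneg.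
  apply/predeqP => x; have [b <-] := phi_surj bphi x; rewrite /L /= fneg f1 gyro_mulg1.
  by split=> [Nb|[c Nc /(bij_inj bphi) <-] //]; exists b.
have ff1 : f (gneg bphi (phi 1)) * f (gneg bphi (phi 1)) = 1.
  by rewrite -gmulfM (gsignedM false false) gyro_mulg1 (gyro_gmulf1 f).
apply: Or32; exists N, L; split => //.
- move=> u v Lu Lv; have fL w : (gneg bphi @` L) w -> f w = 1 by case=> x Lx <-.
  have : gyrokernel f (u * v) by rewrite /gyrokernel /= gmulfM !fL // gyro_mul1g.
  rewrite ME; case/image_gnegE: Lu => us _; case/image_gnegE: Lv => vs _.
  by rewrite image_gUE image_gposE gsignM (negPf us) (negPf vs).
- by apply/eqP/negPn/negP => /set0P.
(* The sign + gives [f a^+ = 1]. The sign - gives [f a^+ = f 1^-], which amounts to [f a^- = 1]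
   because [f a^- = f a^+ * f 1^-] and [f 1^-] squares to [1]. *)
have -> : N `|` phi @^-1` L = [set a | sign_cong f a 1].
  apply/predeqP => a; rewrite /setU /N /L /sign_cong /=; split.
    case=> fa; first by exists true; rewrite /= (gyro_gmulf1 f).
    exists false; apply: (@gyro_mulIg _ (f (gneg bphi (phi 1)))).
    by rewrite -fneg fa ff1.
  case=> [[|] /= fa]; [left|right]; first by rewrite fa (gyro_gmulf1 f).
  by rewrite fneg fa ff1.
exact: normal_subgyrogroup_cong (sign_cong_gyrocongruence f).
Qed.
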